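(* Let $N\ge1$, $\beta>0$, let $W$ be a real symmetric $N\times N$ matrix and $h\in\mathbb{R}^N$, and let $\nu_{\beta,h}$ be the probability measure on $\{-1,1\}^N$ given by $$\nu_{\beta,h}(x)=\frac{1}{\tilde Z_{\beta,h}}e^{-\frac{\beta}{2}\langle x,Wx\rangle+\langle x,h\rangle},\qquad x\in\{-1,1\}^N.$$ Assume that $$|h|\ge 2\beta\sup_{i\in[N]}\sum_{k\ne i}|W_{ik}|.$$ Then for every $f:\{-1,1\}^N\to\mathbb{R}$, $$\mathrm{Var}_{\nu_{\beta,h}}(f)\le\frac{1}{1-2|h|e^{-|h|}}\,\mathcal{E}_{\mathrm{MH}}(f,f),$$ where $\mathcal{E}_{\mathrm{MH}}$ is the Dirichlet form of the Metropolis chain in which, for each site $i\in[N]$, the transition $x\to x^i$ has probability $$P(x^i\mid x)=\min\left\{1,\frac{\nu_{\beta,h}(x^i)}{\nu_{\beta,h}(x)}\right\}=\min\left\{1,e^{2\beta x_i\sum_{j\ne i}W_{ij}x_j-2h_ix_i}\right\}.$$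
   Context: $[N]=\{1,\dots,N\}$, $\langle\cdot,\cdot\rangle$ is the standard inner product, and $\tilde Z_{\beta,h}$ is the normalizing constant. For $h\in\mathbb{R}^N$, $|h|:=\min_{i\in[N]}|h_i|$ (which is the absolute value of the field when the external field is uniform). For $x\in\{-1,1\}^N$, $x^i$ denotes $x$ with its $i$-th coordinate flipped. The dynamics is single-site: the only transitions changing the configuration are $x\to x^i$, $i\in[N]$, and at each site $i$ the configuration is left unchanged with the complementary probability $1-P(x^i\mid x)$ (no additional factor $1/N$). Its Dirichlet form is $$\mathcal{E}_{\mathrm{MH}}(f,f)=\frac12\sum_{x\in\{-1,1\}^N}\sum_{i\in[N]}\nu_{\beta,h}(x)P(x^i\mid x)\left(f(x)-f(x^i)\right)^2 .$$ *)

(* Defs.v *)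
From HB Require Import structures.
From mathcomp Require Import all_boot all_order all_algebra.
From mathcomp Require Import reals sequences exp.

Set Implicit Arguments.
Unset Strict Implicit.
Unset Printing Implicit Defensive.

Import Order.TTheory GRing.Theory Num.Theory.
Local Open Scope ring_scope.

Definition dotp (R : realType) (N : nat) (u v : 'cV[R]_N) : R :=
  \sum_(i < N) u i 0 * v i 0.

(* A point of {-1,1}^N is encoded by booleans so that the configurations form
   a finType; [true] stands for +1 and [false] for -1. *)
Definition config (N : nat) : finType := {ffun 'I_N -> bool}.

Definition spin (R : realType) (N : nat) (x : config N) (i : 'I_N) : R :=
  if x i then 1 else -1.

Definition spins (R : realType) (N : nat) (x : config N) : 'cV[R]_N :=
  \col_(i < N) spin R x i.

Definition flip (N : nat) (x : config N) (i : 'I_N) : config N :=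
  [ffun j => if j == i then ~~ x j else x j].

Definition gibbs_weight (R : realType) (N : nat) (beta : R) (W : 'M[R]_N)
    (h : 'cV[R]_N) (x : config N) : R :=
  expR (- (beta / 2) * dotp (spins R x) (W *m spins R x) + dotp (spins R x) h).

Definition partition_function (R : realType) (N : nat) (beta : R)
    (W : 'M[R]_N) (h : 'cV[R]_N) : R :=
  \sum_(x : config N) gibbs_weight beta W h x.

Definition gibbs (R : realType) (N : nat) (beta : R) (W : 'M[R]_N)
    (h : 'cV[R]_N) (x : config N) : R :=
  (partition_function beta W h)^-1 * gibbs_weight beta W h x.

Definition mean (R : realType) (N : nat) (nu f : config N -> R) : R :=
  \sum_(x : config N) nu x * f x.

Definition variance (R : realType) (N : nat) (nu f : config N -> R) : R :=
  mean nu (fun x => (f x - mean nu f) ^+ 2).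

Definition metropolis (R : realType) (N : nat) (nu : config N -> R)
    (x : config N) (i : 'I_N) : R :=
  Num.min 1 (nu (flip x i) / nu x).

Definition dirichlet_MH (R : realType) (N : nat) (nu f : config N -> R) : R :=
  2^-1 * \sum_(x : config N) \sum_(i < N)
    nu x * metropolis nu x i * (f x - f (flip x i)) ^+ 2.

(* The dimension is a successor so that the minimum is over a nonempty set;
   the initial value of the iterated minimum is one of its terms. *)
Definition min_field (R : realType) (n : nat) (h : 'cV[R]_n.+1) : R :=
  \big[Num.min/`|h ord0 0|]_(i < n.+1) `|h i 0|.

(* The row sums are nonnegative, so starting the maximum at 0 is harmless. *)
Definition max_offdiag_row_sum (R : realType) (N : nat) (W : 'M[R]_N) : R :=
  \big[Num.max/0]_(i < N) \sum_(k < N | k != i) `|W i k|.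

(* Main.v *)
Require Import Defs.
From HB Require Import structures.
From mathcomp Require Import all_boot all_order all_algebra.
From mathcomp Require Import reals sequences exp.
From mathcomp Require Import ring lra.

Set Implicit Arguments.
Unset Strict Implicit.
Unset Printing Implicit Defensive.

Import Order.TTheory GRing.Theory Num.Theory.
Local Open Scope ring_scope.

(** The spectral gap of the chain is bounded below by the rate at which the
    dynamics contracts differences of a function across single flips.

    Let [L f x] be the sum over [i] of [c x i * (f (flip x i) - f x)], with [c]
    the Metropolis rates, and let [M] bound [|f x - f (flip x j)|] over all [x]
    and [j].  Comparing [L f] at [x] and at [flip x j], the disagreement at [j]
    is damped with rate [c x j + c (flip x j) j], the common part of the other
    rates moves it without amplification, and a discrepancy between the rates
    at [i != j] contributes at most [|c x i - c (flip x j) i| * M].  Hence, if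
    the first quantity exceeds the sum of the discrepancies by [kappa] for all
    [x] and [j], then [P = 1 + eps L] maps the bound [M] to
    [(1 - eps * kappa) * M] for small [eps] ([euler_step_contracts]).

    This sup-norm contraction becomes an L2 statement without diagonalizing
    [L].  For [f] centered, the squared L2 norms [b k] of the iterates [P^k f]
    are log-convex, because [P] is self-adjoint; they are also
    [O((1 - eps * kappa) ^ (2 k))], because a centered function is bounded by
    its oscillation.  A log-convex sequence that grows faster at its first step
    than this bound would keep doing so, so already
    [b 1 <= (1 - eps * kappa) ^ 2 * b 0] ([log_convex_first_ratio]).  By
    Cauchy-Schwarz the form [<f, P f> = <f, f> - eps * E(f, f)] is at most
    [(1 - eps * kappa) * <f, f>], that is, [kappa * Var f <= E(f, f)]
    ([poincare_of_path_coupling]).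

    For the Gibbs measure, put [m = min_field h].  The interaction contributes
    at most [m] in absolute value to the log-ratio of weights under a flip, the
    external field at least [2 m], so the field always decides the sign.  A
    spin opposed to its field flips with probability exactly 1, whatever the
    other spins are; a spin aligned with its field flips with probability
    [expR (- u)] for some [u >= m].  One of [x], [flip x j] is opposed at [j],
    so the damping rate is at least 1.  Only aligned sites [i] feel a flip at
    [j], and since [expR (- u)] is [expR (- m)]-Lipschitz on [u >= m] they do so
    by at most [expR (- m) * 4 * beta * |W i j|].  By symmetry of [W] these sum
    to at most [2 * m * expR (- m)], whence
    [kappa = 1 - 2 * m * expR (- m)] ([metropolis_path_coupling]). *)

(** * Growth of log-convex sequences *)

Lemma bernoulli_le_exp (R : realDomainType) (d : R) (k : nat) :
  0 <= d -> 1 + k%:R * d <= (1 + d) ^+ k.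
Proof.
move=> d0; elim: k => [|k IH]; first by rewrite mul0r addr0 expr0.
rewrite exprS -natr1; have k0 : 0 <= k%:R :> R by rewrite ler0n.
apply: (@le_trans _ _ ((1 + d) * (1 + k%:R * d))); first by nra.
by rewrite ler_wpM2l// addr_ge0.
Qed.

(** The ratios of a log-convex sequence increase, so an excess of the first
    ratio over [q] persists and eventually beats any constant [C]. *)
Lemma log_convex_first_ratio (R : realType) (b : nat -> R) (C q : R) :
  0 < q -> (forall k, 0 <= b k) ->
  (forall k, b k.+1 ^+ 2 <= b k * b k.+2) ->
  (forall k, b k <= C * q ^+ k) ->
  b 1%N <= q * b 0%N.
Proof.
move=> q0 b0 bconv bC; rewrite leNgt; apply/negP => lt_b.
have b1_gt0 : 0 < b 1%N by rewrite (le_lt_trans _ lt_b)// mulr_ge0// ltW.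
have b0_gt0 : 0 < b 0%N.
  rewrite lt_neqAle b0 andbT; apply/eqP => b00.
  by have := bconv 0%N; have := b0 2%N; rewrite -b00; nra.
pose t := b 1%N / (q * b 0%N).
have qb0 : 0 < q * b 0%N by rewrite mulr_gt0.
have t1 : 1 < t by rewrite ltr_pdivlMr// mul1r.
have tE : b 1%N = t * q * b 0%N.
  by rewrite -mulrA divfK// gt_eqF.
have tq0 : 0 < t * q by rewrite mulr_gt0// (lt_trans ltr01).
have step k : 0 < b k /\ t * q * b k <= b k.+1.
  elim: k => [|k [bk IH]]; first by rewrite -tE.
  have bk1 : 0 < b k.+1 by rewrite (lt_le_trans _ IH)// mulr_gt0.
  split=> //; rewrite -(ler_pM2l bk); apply: le_trans (bconv k).
  have -> : b k * (t * q * b k.+1) = t * q * b k * b k.+1 by ring.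
  by rewrite expr2 ler_pM2r.
have low k : b 0%N * (t * q) ^+ k <= b k.
  elim: k => [|k IH]; first by rewrite expr0 mulr1.
  rewrite exprS mulrCA; apply: le_trans (step k).2.
  by rewrite ler_pM2l.
have up k : b 0%N * t ^+ k <= C.
  rewrite -(ler_pM2r (exprn_gt0 k q0)) -mulrA -exprMn.
  exact: le_trans (low k) (bC k).
have Cpos : 0 <= C by have := up 0%N; rewrite expr0; lra.
have d0 : 0 < b 0%N * (t - 1) by rewrite mulr_gt0// subr_gt0.
have := archi_boundP (divr_ge0 Cpos (ltW d0)).
set k := Num.Def.archi_bound _; rewrite ltr_pdivrMr// => Ck.
have t0 : 0 <= t - 1 by rewrite subr_ge0 ltW.
have := ler_wpM2l (b0 0%N) (bernoulli_le_exp k t0); rewrite subrKC.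
have := up k; lra.
Qed.

(** * Two estimates on the exponential *)

Lemma expRN_lipschitz (R : realType) (a u v : R) : a <= u -> a <= v ->
  `|expR (- u) - expR (- v)| <= expR (- a) * `|u - v|.
Proof.
wlog uv : u v / u <= v => [wl|] au av.
  have [|/ltW vu] := leP u v; first by move=> uv; exact: wl.
  by rewrite distrC (distrC u); exact: wl.
rewrite ger0_norm ?subr_ge0 ?ler_expR ?lerN2//.
rewrite ler0_norm ?subr_le0// opprB.
have -> : expR (- v) = expR (- u) * expR (u - v).
  by rewrite -expRD; congr expR; ring.
have E1 := expR_ge1Dx (u - v); have E0 := expR_gt0 (- u).
apply: (@le_trans _ _ (expR (- u) * (v - u))).
  have -> : expR (- u) - expR (- u) * expR (u - v) =
    expR (- u) * (1 - expR (u - v)) by ring.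
  rewrite ler_pM2l//; lra.
by rewrite ler_wpM2r ?subr_ge0// ler_expR lerN2.
Qed.

(** The maximum of [m * expR (- m)] is [expR (- 1)], and [2 < expR 1].  Here it is
    derived from [(1 + m / 3) ^+ 3 <= expR m]: the cubic exceeds [2 * m]
    strictly for every [m >= 0], whereas [(1 + m / 2) ^+ 2] touches it at
    [m = 2]. *)
Lemma coupling_rate_gt0 (R : realType) (m : R) :
  0 <= m -> 0 < 1 - 2 * m * expR (- m).
Proof.
move=> m0; have e0 := expR_gt0 m.
rewrite expRN subr_gt0 ltr_pdivrMr// mul1r.
have -> : m = m / 3 + m / 3 + m / 3 by field.
rewrite 2!expRD; have := expR_ge1Dx (m / 3); set y := expR _.
have : 0 <= m / 3 by rewrite divr_ge0.
set t := m / 3 => t0 ty.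
have y2 : (1 + t) * (1 + t) <= y * y by rewrite ler_pM// addr_ge0.
have : (1 + t) * (1 + t) * (1 + t) <= y * y * y.
  by rewrite ler_pM// ?mulr_ge0 ?addr_ge0.
(* This is [(1 + t) ^+ 3 - 2 * (3 * t)], written as a sum of squares and a cube. *)
have : 0 < (1 - 3 * t / 2) ^+ 2 + 3 / 4 * t ^+ 2 + t ^+ 3.
  have [->|t1] := eqVneq t 0; first by rewrite !mulr0 mul0r subr0 !expr0n /= expr1n; lra.
  have tp : 0 < t by rewrite lt_neqAle eq_sym t1.
  have := sqr_ge0 (1 - 3 * t / 2); have := exprn_gt0 2 tp; have := exprn_gt0 3 tp.
  lra.
lra.
Qed.

(** * Single-site flips *)

Lemma flipK (N : nat) (i : 'I_N) : involutive (fun x : config N => flip x i).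
Proof.
by move=> x; apply/ffunP => j; rewrite !ffunE; case: eqP => // _; rewrite negbK.
Qed.

Lemma flipC (N : nat) (x : config N) (i j : 'I_N) :
  flip (flip x i) j = flip (flip x j) i.
Proof. by apply/ffunP => k; rewrite !ffunE; do 2 case: eqP. Qed.

Definition flip_lipschitz (R : realType) (N : nat) (f : config N -> R) (M : R) :=
  forall x j, `|f x - f (flip x j)| <= M.

Lemma flip_lipschitz_ge0 (R : realType) (N : nat) (f : config N.+1 -> R) M :
  flip_lipschitz f M -> 0 <= M.
Proof. by move=> /(_ [ffun=> true] ord0); apply: le_trans. Qed.

Lemma flip_lipschitz_exists (R : realType) (N : nat) (f : config N -> R) :
  exists M, flip_lipschitz f M.
Proof.
exists (\sum_x \sum_j `|f x - f (flip x j)|) => x j.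
rewrite (bigD1 x)//= (bigD1 j)//= -addrA lerDl addr_ge0 ?sumr_ge0// => *.
exact: sumr_ge0.
Qed.

(** Any two configurations are joined by at most [N] flips. *)
Lemma flip_lipschitz_diameter (R : realType) (N : nat) (f : config N -> R) M :
  0 <= M -> flip_lipschitz f M -> forall x y, `|f x - f y| <= N%:R * M.
Proof.
move=> M0 fM x y.
(* The path changes the coordinates of [x] into those of [y] one by one. *)
pose z k : config N := [ffun j : 'I_N => if (j < k)%N then y j else x j].
have z0 : z 0%N = x by apply/ffunP => j; rewrite ffunE.
have zN : z N = y by apply/ffunP => j; rewrite ffunE ltn_ord.
have step k : (k < N)%N -> `|f (z k) - f (z k.+1)| <= M.
  move=> kN; pose i := Ordinal kN.
  have [xy|xy] := eqVneq (x i) (y i).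
    suff -> : z k.+1 = z k by rewrite subrr normr0.
    apply/ffunP => j; rewrite !ffunE ltnS leq_eqVlt.
    case: (eqVneq (j : nat) k) => [jk|] //=.
    by rewrite jk ltnn; have -> : j = i by exact: val_inj.
  suff -> : z k.+1 = flip (z k) i by exact: fM.
  apply/ffunP => j; rewrite !ffunE ltnS leq_eqVlt -val_eqE /=.
  case: (eqVneq (j : nat) k) => [jk|] //=.
  rewrite jk ltnn; have -> : j = i by exact: val_inj.
  by move: xy; case: (x i); case: (y i).
have : forall k, (k <= N)%N -> `|f x - f (z k)| <= k%:R * M.
  elim=> [_|k IH kN]; first by rewrite z0 subrr normr0 mul0r.
  rewrite -natr1 mulrDl mul1r -(subrKA (f (z k))).
  by rewrite (le_trans (ler_normD _ _))// lerD ?step// IH// ltnW.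
by move=> /(_ N (leqnn N)); rewrite zN.
Qed.

(** * From path coupling to a Poincare inequality *)

Definition inner (R : realType) (N : nat) (nu f g : config N -> R) : R :=
  \sum_x nu x * (f x * g x).

Definition dirichlet (R : realType) (N : nat) (nu : config N -> R)
    (c : config N -> 'I_N -> R) (f g : config N -> R) : R :=
  2^-1 * \sum_x \sum_i
    nu x * c x i * ((f x - f (flip x i)) * (g x - g (flip x i))).

(** The operator [1 + eps L], where [L] is the generator with flip rates [c]; for
    small [eps] it is a Markov kernel. *)
Definition euler_step (R : realType) (N : nat) (c : config N -> 'I_N -> R)
    (eps : R) (f : config N -> R) (x : config N) : R :=
  f x + eps * \sum_i c x i * (f (flip x i) - f x).

Lemma inner_sqr_ge0 (R : realType) (N : nat) (nu f : config N -> R) :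
  (forall x, 0 <= nu x) -> 0 <= inner nu f f.
Proof.
by move=> nu0; apply: sumr_ge0 => x _; rewrite mulr_ge0// -expr2 sqr_ge0.
Qed.

Lemma inner_cauchy_schwarz (R : realType) (N : nat) (nu f g : config N -> R) :
  (forall x, 0 <= nu x) ->
  inner nu f g ^+ 2 <= inner nu f f * inner nu g g.
Proof.
move=> nu0.
(* The quadratic form in [(a, b)] given by the square norm of [a f + b g]. *)
have quad a b : 0 <= a ^+ 2 * inner nu f f + 2 * a * b * inner nu f g
                     + b ^+ 2 * inner nu g g.
  have -> : a ^+ 2 * inner nu f f + 2 * a * b * inner nu f g
      + b ^+ 2 * inner nu g g
    = inner nu (fun x => a * f x + b * g x) (fun x => a * f x + b * g x).
    rewrite /inner !mulr_sumr -!big_split/=; apply: eq_bigr => x _; ring.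
  exact: inner_sqr_ge0.
have F0 := inner_sqr_ge0 f nu0; have G0 := inner_sqr_ge0 g nu0.
move: F0 G0 quad; set F := inner nu f f; set G := inner nu g g.
set H := inner nu f g => F0 G0 quad.
have [F_gt0|F_le0] := ltrP 0 F.
  have := quad (- H) F; have -> : (- H) ^+ 2 * F + 2 * - H * F * H + F ^+ 2 * G
    = F * (F * G - H ^+ 2) by ring.
  by rewrite pmulr_rge0// subr_ge0.
have F00 : F = 0 by apply/eqP; rewrite eq_le F_le0.
have [->|H0] := eqVneq H 0; first by rewrite expr0n F00 mul0r.
(* With [F = 0] the form is affine in [a], and this [a] makes it equal to -1. *)
have := quad (- (G + 1) / (2 * H)) 1.
have -> : 2 * (- (G + 1) / (2 * H)) * 1 * H = - (G + 1) by field.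
rewrite F00; lra.
Qed.

(** Summation by parts for one flip: averaging the sum with its image under the
    measure-preserving change of variable [x -> flip x i] symmetrizes it. *)
Lemma flip_sum_by_parts (R : realType) (N : nat) (i : 'I_N)
    (w f g : config N -> R) :
  (forall x, w (flip x i) = w x) ->
  \sum_x w x * (f x * (g (flip x i) - g x)) =
  - (2^-1 * \sum_x w x * ((f x - f (flip x i)) * (g x - g (flip x i)))).
Proof.
move=> wE; set S := LHS.
have SE : S = \sum_x w x * (f (flip x i) * (g x - g (flip x i))).
  rewrite /S (reindex_inj (inv_inj (@flipK N i)))/=.
  by apply: eq_bigr => x _; rewrite wE flipK.
suff -> : \sum_x w x * ((f x - f (flip x i)) * (g x - g (flip x i))) = - (S + S).
  by field.
rewrite {2}SE /S -big_split -sumrN /=; apply: eq_bigr => x _; ring.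
Qed.

Section Reversible.
Variables (R : realType) (n : nat).
Let N := n.+1.
Variable nu : config N -> R.
Variable c : config N -> 'I_N -> R.
Hypothesis nu_gt0 : forall x, 0 < nu x.
Hypothesis nu_sum1 : \sum_x nu x = 1.
Hypothesis detailed_balance :
  forall x i, nu (flip x i) * c (flip x i) i = nu x * c x i.
Hypothesis c_ge0 : forall x i, 0 <= c x i.
Hypothesis c_le1 : forall x i, c x i <= 1.

Let nu_ge0 x : 0 <= nu x. Proof. exact: ltW. Qed.

(** Self-adjointness, conservation of the mean and the link with the Dirichlet
    form are all read off from this identity. *)
Lemma inner_euler_step eps f g :
  inner nu f (euler_step c eps g) = inner nu f g - eps * dirichlet nu c f g.
Proof.
rewrite /inner /dirichlet /euler_step.
transitivity (inner nu f g + eps * \sum_x \sum_i nu x * c x i *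
    (f x * (g (flip x i) - g x))).
  rewrite /inner mulr_sumr -big_split/=; apply: eq_bigr => x _.
  rewrite !mulrDr; congr (_ + _).
  rewrite [RHS]mulr_sumr !mulr_sumr; apply: eq_bigr => i _; ring.
congr (_ + _); rewrite -mulrN; congr (_ * _).
rewrite exchange_big/= [in RHS]exchange_big/= mulr_sumr -sumrN.
by apply: eq_bigr => i _; apply: flip_sum_by_parts => x; exact: detailed_balance.
Qed.

Lemma innerC f g : inner nu f g = inner nu g f.
Proof. by apply: eq_bigr => x _; rewrite (mulrC (f x)). Qed.

Lemma dirichletC f g : dirichlet nu c f g = dirichlet nu c g f.
Proof.
congr (_ * _); apply: eq_bigr => x _; apply: eq_bigr => i _.
by congr (_ * _); exact: mulrC.
Qed.

Lemma euler_step_selfadjoint eps f g :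
  inner nu (euler_step c eps f) g = inner nu f (euler_step c eps g).
Proof. by rewrite innerC !inner_euler_step innerC dirichletC. Qed.

Lemma mean_euler_step eps f : mean nu (euler_step c eps f) = mean nu f.
Proof.
have meanE g : mean nu g = inner nu (fun=> 1) g.
  by apply: eq_bigr => x _; rewrite mul1r.
rewrite !meanE inner_euler_step /dirichlet.
rewrite [X in _ - _ * (_ * X)]big1 ?mulr0 ?subr0// => x _.
by rewrite big1// => i _; rewrite subrr mul0r mulr0.
Qed.

(** Path coupling. The bound on [eps] makes the coefficient of
    [f x - f (flip x j)] nonnegative, so that it can be added to the other
    contributions without losing cancellations. *)
Lemma euler_step_contracts (kappa eps : R) f (M : R) :
  (forall x j, kappa <= c x j + c (flip x j) j
     - \sum_(i | i != j) `|c x i - c (flip x j) i|) ->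
  0 <= eps -> eps * (N%:R + 2) <= 1 -> 0 <= M ->
  flip_lipschitz f M ->
  flip_lipschitz (euler_step c eps f) ((1 - eps * kappa) * M).
Proof.
move=> hk eps0 epsN M0 fM x j.
(* [d] is the old difference; in [A] both copies flip [i != j] with the rates
   of [x], and [B] corrects the rates of the second copy. *)
set d := f x - f (flip x j).
set C := \sum_(i | i != j) c x i.
set A := \sum_(i | i != j) c x i * (f (flip x i) - f (flip (flip x i) j)).
set B := \sum_(i | i != j) (c x i - c (flip x j) i) *
   (f (flip (flip x j) i) - f (flip x j)).
set D := \sum_(i | i != j) `|c x i - c (flip x j) i|.
have -> : euler_step c eps f x - euler_step c eps f (flip x j) =
   (1 - eps * (c x j + c (flip x j) j + C)) * d + eps * A + eps * B.
  rewrite /euler_step (bigD1 j)//= [X in _ - (_ + _ * X)](bigD1 j)//= flipK.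
  have -> : \sum_(i | i != j) c x i * (f (flip x i) - f x) =
     A + B - C * d + \sum_(i | i != j) c (flip x j) i *
         (f (flip (flip x j) i) - f (flip x j)).
    rewrite /A /B /C mulr_suml -!big_split -sumrB -big_split/=.
    by apply: eq_bigr => i _; rewrite /d (flipC x j i); ring.
  by rewrite /d; ring.
have CN : C <= N%:R.
  rewrite (@le_trans _ _ (\sum_(i < N) 1))//; last by rewrite sumr_const card_ord.
  rewrite [leRHS](bigD1 j)//= -[leLHS]add0r lerD//; exact: ler_sum.
have coef : 0 <= 1 - eps * (c x j + c (flip x j) j + C).
  rewrite subr_ge0 (le_trans _ epsN)// ler_wpM2l//.
  have := c_le1 x j; have := c_le1 (flip x j) j; lra.
have dM : `|(1 - eps * (c x j + c (flip x j) j + C)) * d| <=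
    (1 - eps * (c x j + c (flip x j) j + C)) * M.
  by rewrite normrM ger0_norm// ler_wpM2l//; exact: fM.
have AM : `|eps * A| <= eps * (C * M).
  rewrite normrM ger0_norm// ler_wpM2l// /C mulr_suml.
  rewrite (le_trans (ler_norm_sum _ _ _))//; apply: ler_sum => i _.
  by rewrite normrM ger0_norm// ler_wpM2l.
have BM : `|eps * B| <= eps * (D * M).
  rewrite normrM ger0_norm// ler_wpM2l// /D mulr_suml.
  rewrite (le_trans (ler_norm_sum _ _ _))//; apply: ler_sum => i _.
  by rewrite normrM ler_wpM2l// distrC.
apply: (@le_trans _ _ ((1 - eps * (c x j + c (flip x j) j + C)) * M
  + eps * (C * M) + eps * (D * M))).
  apply: (le_trans (ler_normD _ _)); apply: lerD BM.
  exact: le_trans (ler_normD _ _) (lerD dM AM).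
have := ler_wpM2r M0 (ler_wpM2l eps0 (hk x j)); rewrite -/D; lra.
Qed.

(** A centered function is its own average difference to its other values. *)
Lemma norm_le_diameter_of_mean0 f (D : R) :
  (forall x y, `|f x - f y| <= D) -> mean nu f = 0 ->
  forall x, `|f x| <= D.
Proof.
move=> fD f0 x.
have -> : f x = \sum_y nu y * (f x - f y).
  under eq_bigr do rewrite mulrBr.
  by rewrite sumrB -mulr_suml nu_sum1 mul1r -/(mean nu f) f0 subr0.
rewrite (le_trans (ler_norm_sum _ _ _))// -[leRHS]mul1r -nu_sum1 mulr_suml.
by apply: ler_sum => y _; rewrite normrM gtr0_norm// ler_pM2l.
Qed.

(** The contraction rate in the Lipschitz seminorm is transferred to L2 by
    log-convexity of the squared norms of the iterates. *)
Lemma poincare_centered (kappa : R) f :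
  (forall x j, kappa <= c x j + c (flip x j) j
     - \sum_(i | i != j) `|c x i - c (flip x j) i|) ->
  mean nu f = 0 ->
  kappa * inner nu f f <= dirichlet nu c f f.
Proof.
move=> hk f0.
(* [N + 2] would suffice for the contraction; [N + 3] keeps [rho] positive. *)
pose eps : R := (N%:R + 3)^-1; pose rho := 1 - eps * kappa.
have N3 : 0 < N%:R + 3 :> R by rewrite ltr_wpDl.
have eps0 : 0 < eps by rewrite invr_gt0.
have epsN : eps * (N%:R + 3) = 1 by rewrite mulVf// gt_eqF.
have epsN2 : eps * (N%:R + 2) <= 1 by lra.
have k2 : kappa <= 2.
  pose x : config N := [ffun=> true].
  have := hk x ord0; have := c_le1 x ord0; have := c_le1 (flip x ord0) ord0.
  have : 0 <= \sum_(i | i != ord0) `|c x i - c (flip x ord0) i| by exact: sumr_ge0.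
  lra.
have rho0 : 0 < rho.
  have N0 : 0 <= eps * N%:R by rewrite mulr_ge0// ltW.
  have := ler_wpM2l (ltW eps0) k2; rewrite /rho; lra.
pose P := euler_step c eps.
pose u k := iter k P f.
pose b k := inner nu (u k) (u k).
have bS k : b k.+1 ^+ 2 <= b k * b k.+2.
  rewrite (_ : b k.+1 = inner nu (u k) (u k.+2)); first exact: inner_cauchy_schwarz.
  by rewrite /b /= euler_step_selfadjoint.
have [M fM] := flip_lipschitz_exists f.
have M0 := flip_lipschitz_ge0 fM.
have uM k : flip_lipschitz (u k) (rho ^+ k * M).
  elim: k => [|k IH]; first by rewrite expr0 mul1r.
  rewrite exprS -mulrA; apply: euler_step_contracts => //; first exact: ltW.
  by rewrite mulr_ge0// exprn_ge0// ltW.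
have u0 k : mean nu (u k) = 0.
  by elim: k => //= k IH; rewrite mean_euler_step.
have bM k : b k <= (N%:R * M) ^+ 2 * (rho ^+ 2) ^+ k.
  have ux x : `|u k x| <= N%:R * M * rho ^+ k.
    rewrite -mulrA (mulrC M); apply: norm_le_diameter_of_mean0 (u0 k) x.
    apply: flip_lipschitz_diameter (uM k).
    by rewrite mulr_ge0// exprn_ge0// ltW.
  rewrite -exprM mulnC exprM -exprMn -[leRHS]mul1r -[X in _ <= X * _]nu_sum1 mulr_suml.
  apply: ler_sum => x _; rewrite ler_pM2l// -expr2 -[leLHS]real_normK ?num_real//.
  by rewrite lerXn2r ?nnegrE// (le_trans _ (ux x)).
have ratio : b 1%N <= rho ^+ 2 * b 0%N.
  apply: log_convex_first_ratio bS bM; first exact: exprn_gt0.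
  by move=> k; apply: inner_sqr_ge0.
have ip : inner nu f (P f) <= rho * inner nu f f.
  have F0 := inner_sqr_ge0 f nu_ge0.
  rewrite (le_trans (ler_norm _))// -ler_sqr ?nnegrE ?mulr_ge0 ?(ltW rho0)//.
  rewrite real_normK ?num_real// (le_trans (inner_cauchy_schwarz _ _ nu_ge0))//.
  by rewrite exprMn expr2 [inner _ _ _ ^+ 2]expr2 [leRHS]mulrCA ler_wpM2l.
move: ip; rewrite inner_euler_step /rho mulrBl mul1r lerD2l lerN2 -mulrA.
by rewrite ler_pM2l.
Qed.

(** Neither side changes when a constant is added to [f]. *)
Theorem poincare_of_path_coupling (kappa : R) f :
  (forall x j, kappa <= c x j + c (flip x j) j
     - \sum_(i | i != j) `|c x i - c (flip x j) i|) ->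
  kappa * variance nu f <= dirichlet nu c f f.
Proof.
move=> hk; pose g x := f x - mean nu f.
have g0 : mean nu g = 0.
  rewrite /mean; under eq_bigr do rewrite mulrBr.
  by rewrite sumrB -mulr_suml nu_sum1 mul1r subrr.
have -> : dirichlet nu c f f = dirichlet nu c g g.
  congr (_ * _); apply: eq_bigr => x _; apply: eq_bigr => i _.
  by rewrite /g !opprB !addrA !subrK.
have -> : variance nu f = inner nu g g.
  by apply: eq_bigr => x _; rewrite expr2.
exact: poincare_centered.
Qed.

End Reversible.

(** * Metropolis rates of the Gibbs measure *)

(** Both sides are the minimum of [nu x] and [nu (flip x i)]. *)
Lemma metropolis_reversible (R : realType) (N : nat) (nu : config N -> R) :
  (forall x, 0 < nu x) ->
  forall x i, nu (flip x i) * metropolis nu (flip x i) i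
              = nu x * metropolis nu x i.
Proof.
move=> nu0 x i; rewrite /metropolis flipK !minr_pMr ?(ltW (nu0 _))// !mulr1.
have cancel a b : nu a * (nu b / nu a) = nu b by rewrite mulrC divfK// gt_eqF.
by rewrite !cancel minC.
Qed.

Lemma metropolis_ge0 (R : realType) (N : nat) (nu : config N -> R) x i :
  (forall x, 0 < nu x) -> 0 <= metropolis nu x i.
Proof. by move=> nu0; rewrite le_min ler01 divr_ge0// ltW. Qed.

Lemma metropolis_le1 (R : realType) (N : nat) (nu : config N -> R) x i :
  metropolis nu x i <= 1.
Proof. by rewrite ge_min lexx. Qed.

Lemma spin_flip (R : realType) (N : nat) (x : config N) (i j : 'I_N) :
  spin R (flip x i) j = if j == i then - spin R x j else spin R x j.
Proof.
by rewrite /spin ffunE; case: eqP => // _; case: (x j) => //=; rewrite opprK.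
Qed.

Lemma spin_sqr (R : realType) (N : nat) (x : config N) (i : 'I_N) :
  spin R x i * spin R x i = 1.
Proof. by rewrite /spin; case: (x i); rewrite ?mulr1// mulrN1 opprK. Qed.

Lemma norm_spin (R : realType) (N : nat) (x : config N) (i : 'I_N) : `|spin R x i| = 1.
Proof. by rewrite /spin; case: (x i); rewrite ?normrN normr1. Qed.

Definition local_field (R : realType) (N : nat) (W : 'M[R]_N) (x : config N)
    (i : 'I_N) : R :=
  \sum_(j < N | j != i) W i j * spin R x j.

Lemma dotp_spins_flip (R : realType) (N : nat) (h : 'cV[R]_N) (x : config N) i :
  dotp (spins R (flip x i)) h = dotp (spins R x) h - 2 * h i 0 * spin R x i.
Proof.
rewrite /dotp (bigD1 i)//= [in RHS](bigD1 i)//= !mxE spin_flip eqxx.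
under eq_bigr => j ji do rewrite mxE spin_flip (negPf ji).
under [in RHS]eq_bigr => j ji do rewrite mxE.
ring.
Qed.

(** Split the quadratic form according to whether the indices equal [i]. The
    diagonal term does not depend on the configuration, since spins square to
    1; the block without [i] does not see the flip; the cross terms, doubled by
    the symmetry of [W], change sign. *)
Lemma interaction_flip (R : realType) (N : nat) (W : 'M[R]_N) (x : config N) i :
  W^T = W ->
  dotp (spins R (flip x i)) (W *m spins R (flip x i)) =
  dotp (spins R x) (W *m spins R x) - 4 * spin R x i * local_field W x i.
Proof.
move=> WT; have Wsym j k : W j k = W k j by rewrite -[in LHS]WT mxE.
have E y : dotp (spins R y) (W *m spins R y) =
    W i i + 2 * spin R y i * local_field W y i +
    \sum_(j | j != i) \sum_(k | k != i) spin R y j * W j k * spin R y k.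
  rewrite /dotp (bigD1 i)//= !mxE (bigD1 i)//= !mxE.
  under eq_bigr => k _ do rewrite mxE.
  rewrite -/(local_field W y i).
  have -> : \sum_(j | j != i) (spins R y) j 0 * (W *m spins R y) j 0 =
      \sum_(j | j != i) (spin R y i * (W i j * spin R y j) +
        \sum_(k | k != i) spin R y j * W j k * spin R y k).
    apply: eq_bigr => j _; rewrite !mxE (bigD1 i)//= !mxE mulrDr; congr (_ + _).
      by rewrite (Wsym j); ring.
    by rewrite mulr_sumr; apply: eq_bigr => k _; rewrite mxE mulrA.
  rewrite big_split/= -mulr_sumr -/(local_field W y i).
  have := spin_sqr R y i; set s := spin R y i => ss.
  have -> : s * (W i i * s + local_field W y i) = s * s * W i i + s * local_field W y i by ring.
  by rewrite ss; ring.
rewrite !E spin_flip eqxx.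
have -> : local_field W (flip x i) i = local_field W x i.
  by apply: eq_bigr => j ji; rewrite spin_flip (negPf ji).
have -> : \sum_(j | j != i) \sum_(k | k != i)
    spin R (flip x i) j * W j k * spin R (flip x i) k =
  \sum_(j | j != i) \sum_(k | k != i) spin R x j * W j k * spin R x k.
  apply: eq_bigr => j ji; apply: eq_bigr => k ki.
  by rewrite !spin_flip (negPf ji) (negPf ki).
ring.
Qed.

Lemma local_field_flip (R : realType) (N : nat) (W : 'M[R]_N) (x : config N) i j : i != j ->
  local_field W x i - local_field W (flip x j) i = 2 * W i j * spin R x j.
Proof.
move=> ij; rewrite /local_field (bigD1 j) ?[X in _ - X](bigD1 j) /= 1?eq_sym//.
rewrite spin_flip eqxx.
under [X in _ - (_ + X)]eq_bigr => k /andP[_ kj] do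
  rewrite spin_flip (negPf kj).
ring.
Qed.

Section GibbsRates.
Variables (R : realType) (n : nat) (beta : R) (W : 'M[R]_n.+1).
Variable h : 'cV[R]_n.+1.
Hypothesis W_sym : W^T = W.
Let N := n.+1.

Lemma partition_function_gt0 : 0 < partition_function beta W h.
Proof.
rewrite /partition_function (bigD1 [ffun=> true])//= ltr_pwDl ?expR_gt0//.
by apply: sumr_ge0 => x _; exact: expR_ge0.
Qed.

Lemma gibbs_gt0 x : 0 < gibbs beta W h x.
Proof. by rewrite mulr_gt0 ?invr_gt0 ?partition_function_gt0 ?expR_gt0. Qed.

Lemma gibbs_sum1 : \sum_x gibbs beta W h x = 1.
Proof. by rewrite -mulr_sumr mulVf// gt_eqF// partition_function_gt0. Qed.

(** This is minus the logarithm of the ratio of the weights of the flipped and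
    the original configuration. *)
Definition flip_cost (x : config N) i : R :=
  spin R x i * (2 * h i 0 - 2 * beta * local_field W x i).

Lemma metropolis_gibbsE x i :
  metropolis (gibbs beta W h) x i =
  Num.min 1 (expR (2 * beta * spin R x i * local_field W x i
                   - 2 * h i 0 * spin R x i)).
Proof.
rewrite /metropolis /gibbs -mulf_div divff ?mul1r; last first.
  by rewrite invr_eq0 gt_eqF// partition_function_gt0.
rewrite /gibbs_weight -expRB (dotp_spins_flip h) interaction_flip//.
by congr (Num.min 1 (expR _)); field.
Qed.

Hypothesis beta_gt0 : 0 < beta.
Let m := min_field h.
Hypothesis h_large : m >= 2 * beta * max_offdiag_row_sum W.

Lemma min_field_ge0 : 0 <= m.
Proof. by apply: le_bigmin. Qed.

Lemma min_field_le i : m <= `|h i 0|.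
Proof. exact: bigmin_le. Qed.

Lemma offdiag_row_sum_le i :
  2 * beta * \sum_(k < N | k != i) `|W i k| <= m.
Proof.
apply: le_trans h_large; rewrite ler_pM2l ?mulr_gt0//.
exact: (le_bigmax _ (fun i => \sum_(k < N | k != i) `|W i k|)).
Qed.

Lemma local_field_le x i : `|2 * beta * local_field W x i| <= m.
Proof.
apply: le_trans (offdiag_row_sum_le i).
have b2 : 0 < 2 * beta by rewrite mulr_gt0.
rewrite normrM gtr0_norm// ler_pM2l//.
rewrite (le_trans (ler_norm_sum _ _ _))//; apply: ler_sum => k _.
by rewrite normrM norm_spin mulr1.
Qed.

(** The field contributes at most [- 2 m] to the flip cost and the interaction
    at most [m], so the flip does not
    decrease the weight. *)
Lemma metropolis_misaligned x i : spin R x i * h i 0 <= 0 ->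
  metropolis (gibbs beta W h) x i = 1.
Proof.
move=> sh; rewrite metropolis_gibbsE min_l// -[leLHS]expR0 ler_expR.
have := local_field_le x i; have := min_field_le i.
have : `|h i 0| = - (spin R x i * h i 0).
  by rewrite -ler0_norm// normrM norm_spin mul1r.
have : `|spin R x i * (2 * beta * local_field W x i)|
    = `|2 * beta * local_field W x i| by rewrite normrM norm_spin mul1r.
move=> <- -> mh; rewrite ler_norml => /andP[].
have := min_field_ge0; lra.
Qed.

(** The field contributes at least [2 m] to the flip cost and the interaction at
    least [- m]. *)
Lemma metropolis_aligned x i : 0 <= spin R x i * h i 0 ->
  m <= flip_cost x i /\
  metropolis (gibbs beta W h) x i = expR (- flip_cost x i).
Proof.
move=> sh.
have mu : m <= flip_cost x i.
  have := local_field_le x i; have := min_field_le i.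
  have : `|h i 0| = spin R x i * h i 0.
    by rewrite -[RHS]ger0_norm// normrM norm_spin mul1r.
  have : `|spin R x i * (2 * beta * local_field W x i)|
      = `|2 * beta * local_field W x i| by rewrite normrM norm_spin mul1r.
  move=> <- -> mh; rewrite ler_norml /flip_cost => /andP[]; lra.
split=> //; rewrite metropolis_gibbsE.
have -> : 2 * beta * spin R x i * local_field W x i - 2 * h i 0 * spin R x i =
   - flip_cost x i by rewrite /flip_cost; ring.
by rewrite min_r// expR_le1 oppr_le0 (le_trans min_field_ge0).
Qed.

(** Flipping [j] leaves the alignment of [i] with its field unchanged.  Opposed
    spins keep probability 1; for aligned spins the flip cost moves by
    [4 * beta * |W i j|] within the region where the exponential has slope at
    most [expR (- m)]. *)
Lemma metropolis_influence x i j : i != j ->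
  `|metropolis (gibbs beta W h) x i - metropolis (gibbs beta W h) (flip x j) i|
  <= expR (- m) * (4 * beta * `|W i j|).
Proof.
move=> ij.
have sE : spin R (flip x j) i = spin R x i by rewrite spin_flip (negPf ij).
have [sh|/ltW sh] := leP (spin R x i * h i 0) 0.
  rewrite !metropolis_misaligned ?sE// subrr normr0.
  by rewrite mulr_ge0 ?expR_ge0// !mulr_ge0// ltW.
have [mu ->] := metropolis_aligned sh.
have [|mv ->] := @metropolis_aligned (flip x j) i; first by rewrite sE.
apply: le_trans (expRN_lipschitz mu mv) _; rewrite ler_pM2l ?expR_gt0//.
have -> : flip_cost x i - flip_cost (flip x j) i =
    - (spin R x i * (4 * beta * (W i j * spin R x j))).
  rewrite /flip_cost sE -mulrBr.
  have -> : 2 * h i 0 - 2 * beta * local_field W x i -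
    (2 * h i 0 - 2 * beta * local_field W (flip x j) i) =
    - (2 * beta * (local_field W x i - local_field W (flip x j) i)) by ring.
  by rewrite local_field_flip//; ring.
rewrite normrN normrM norm_spin mul1r normrM [`|_ * spin _ _ _|]normrM norm_spin.
by rewrite mulr1 ger0_norm// mulr_ge0// ltW.
Qed.

(** One of [x] and [flip x j] opposes the field at [j], so the flips at [j] have
    total rate at least 1.  The influences of [j] on the other sites run along
    a column of [W], which symmetry turns into a row. *)
Lemma metropolis_path_coupling x j :
  1 - 2 * m * expR (- m) <=
  metropolis (gibbs beta W h) x j + metropolis (gibbs beta W h) (flip x j) j
  - \sum_(i | i != j) `|metropolis (gibbs beta W h) x i
                        - metropolis (gibbs beta W h) (flip x j) i|.
Proof.
have c1 : 1 <= metropolis (gibbs beta W h) x j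
              + metropolis (gibbs beta W h) (flip x j) j.
  have [sh|/ltW sh] := leP (spin R x j * h j 0) 0.
    by rewrite metropolis_misaligned// lerDl metropolis_ge0//; exact: gibbs_gt0.
  rewrite [X in _ + X]metropolis_misaligned ?lerDr ?metropolis_ge0//.
    exact: gibbs_gt0.
  by rewrite spin_flip eqxx mulNr oppr_le0.
apply: lerB => //.
apply: (@le_trans _ _ (\sum_(i | i != j) expR (- m) * (4 * beta * `|W i j|))).
  by apply: ler_sum => i ij; exact: metropolis_influence.
rewrite -!mulr_sumr (mulrC _ (expR _)) ler_pM2l ?expR_gt0//.
have := offdiag_row_sum_le j.
have -> : \sum_(k < N | k != j) `|W j k| = \sum_(i | i != j) `|W i j|.
  by apply: eq_bigr => i _; rewrite -[in LHS]W_sym mxE.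
lra.
Qed.

End GibbsRates.

Theorem theorem4p5 (R : realType) (n : nat) (beta : R) (W : 'M[R]_n.+1)
    (h : 'cV[R]_n.+1) (beta_gt0 : 0 < beta) (W_sym : W^T = W)
    (h_large : min_field h >= 2 * beta * max_offdiag_row_sum W) :
  (forall (x : config n.+1) (i : 'I_n.+1),
     metropolis (gibbs beta W h) x i =
     Num.min 1 (expR (2 * beta * spin R x i *
                        (\sum_(j < n.+1 | j != i) W i j * spin R x j)
                      - 2 * h i 0 * spin R x i))) /\
  (forall f : config n.+1 -> R,
     variance (gibbs beta W h) f <=
     1 / (1 - 2 * min_field h * expR (- min_field h)) *
       dirichlet_MH (gibbs beta W h) f).
Proof.
have nu0 := gibbs_gt0 beta W h.
split=> [x i|f]; first exact: metropolis_gibbsE.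
rewrite mulrAC mul1r ler_pdivlMr ?coupling_rate_gt0 ?min_field_ge0// mulrC.
apply: (@poincare_of_path_coupling _ _ _ (metropolis (gibbs beta W h))) => //.
- exact: gibbs_sum1.
- exact: metropolis_reversible.
- by move=> x i; exact: metropolis_ge0.
- by move=> x i; exact: metropolis_le1.
- by move=> x j; exact: metropolis_path_coupling.
Qed.
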